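(* Let $\{X_n\}_{n\ge 0}$ be the reflecting random walk on the half-strip $S=\{0,1,2,\ldots\}\times\{1,\ldots,d\}$ with blocks $P_0$ and $(P_n,Q_n,R_n)_{n\ge1}$ satisfying conditions $C_1$, $C_2$, $C_3$ (all as described in the context), started from layer $0$ with an initial distribution $\mu$. Define $$\varrho_1^{+}=\mathbf 1' P_0\Big(\sum_{k\ge1}A_1^{-}A_2^{-}\cdots A_{k-1}^{-}\mathbf u_k^{-}\Big)+d ,$$ where $\mathbf 1'$ is the row vector of ones and the empty product ($k=1$) is the identity. Then the random walk is positive recurrent if and only if $\varrho_1^{+}<\infty$.
   Context: Setting: let $d\ge 1$ be an integer. $X_n=(\xi_n,Y_n)$, $n\ge0$, is a time-homogeneous Markov chain on $S=\{0,1,2,\ldots\}\times\{1,\ldots,d\}$; layer $n$ is $L_n=\{(n,i):1\le i\le d\}$. There are nonnegative $d\times d$ matrices $P_0$ and $P_n,Q_n,R_n$ ($n\ge1$) with $P_0\mathbf 1=\mathbf 1$ and $(P_n+Q_n+R_n)\mathbf 1=\mathbf 1$ for $n\ge 1$, where $\mathbf 1$ is the column vector of ones. From $(0,i)$ the chain moves to $(1,j)$ with probability $P_0(i,j)$; from $(n,i)$ with $n\ge1$ it moves to $(n+1,j)$, $(n,j)$, $(n-1,j)$ with probability $P_n(i,j)$, $R_n(i,j)$, $Q_n(i,j)$ respectively. Standing conditions (under which the chain is irreducible), with $\|B\|=\max_i\sum_j|b_{ij}|$: $C_1$: for every $n\ge1$, $\log(1-\|R_n+P_n\|)^{-1}<\infty$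 and $\log(1-\|R_n+Q_n\|)^{-1}<\infty$ (i.e. both norms are $<1$). $C_2$: for every $n$ and $j$, $\sum_{i=1}^d P_n(i,j)>0$ ($n\ge0$) and $\sum_{i=1}^d Q_n(i,j)>0$ ($n\ge1$). $C_3$: all states of layer $0$ lie in one communication class. Definitions: let $\rho$ be a stochastic $d\times d$ matrix. For $a\ge1$ put $\zeta_{a,a}^{-}=\rho$ and, for $1\le n<a$, $\zeta_{n,a}^{-}=(I-P_n\zeta_{n+1,a}^{-}-R_n)^{-1}Q_n$. It is part of the setting (taken as given from the literature) that for each $n\ge1$ the limit $\zeta_n^{-}=\lim_{a\to\infty}\zeta_{n,a}^{-}$ exists; the $\zeta_n^-$ are stochastic and satisfy $\zeta_n^{-}=(I-P_n\zeta_{n+1}^{-}-R_n)^{-1}Q_n$. For $n\ge1$, $$A_n^{-}=(I-P_n\zeta_{n+1}^{-}-R_n)^{-1}P_n,\qquad \mathbf u_n^{-}=(I-P_n\zeta_{n+1}^{-}-R_n)^{-1}\mathbf 1 .$$ With $T_y^{+}=\inf\{t\ge1: X_t\in L_y\}$, layer $y$ is called positive recurrent if the expected value of $T_y^{+}$ is finite when the walk starts in $L_y$ (from every state of $L_y$); the walk is positive recurrent if its layers are (equivalently, the irreducible chain is positive recurrent). *)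

(* Defs.v *)
From HB Require Import structures.
From mathcomp Require Import all_boot all_order all_algebra.
From mathcomp Require Import all_classical all_reals all_analysis.

Set Implicit Arguments.
Unset Strict Implicit.
Unset Printing Implicit Defensive.

Import Order.TTheory GRing.Theory Num.Theory.
Import numFieldTopology.Exports numFieldNormedType.Exports.

Local Open Scope classical_set_scope.
Local Open Scope ring_scope.

Definition stochastic (K : realType) (d : nat) (M : 'M[K]_d) : Prop :=
  (forall i j, 0 <= M i j) /\ (forall i, \sum_j M i j = 1).

(* The operator norm max_i sum_j |b_ij|; not the library norm on matrices,
   which is the largest absolute value of an entry. *)
Definition row_norm (K : realType) (d : nat) (B : 'M[K]_d) : K :=
  \big[Num.max/0]_(i < d) \sum_(j < d) `|B i j|.

(* The blocks are sequences indexed by the layer; the entries Q 0 and R 0 have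
   no meaning and are never used. *)
Definition block_transitions (K : realType) (d : nat)
    (P Q R : nat -> 'M[K]_d) : Prop :=
  [/\ forall n i j, 0 <= P n i j,
      forall n i j, (0 < n)%N -> 0 <= Q n i j /\ 0 <= R n i j,
      P 0%N *m const_mx 1 = const_mx 1 :> 'cV[K]_d
    & forall n, (0 < n)%N ->
        (P n + Q n + R n) *m const_mx 1 = const_mx 1 :> 'cV[K]_d].

Definition strip (d : nat) := (nat * 'I_d)%type.

Definition layer (d n : nat) : set (strip d) := [set x | x.1 = n].

Definition transition (K : realType) (d : nat) (P Q R : nat -> 'M[K]_d)
    (x y : strip d) : K :=
  if y.1 == x.1.+1 then P x.1 x.2 y.2
  else if x.1 == 0%N then 0
  else if y.1 == x.1 then R x.1 x.2 y.2
  else if y.1.+1 == x.1 then Q x.1 x.2 y.2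
  else 0.

Fixpoint transition_iter (K : realType) (S : choiceType) (p : S -> S -> K)
    (m : nat) (x y : S) : \bar K :=
  if m is m'.+1 then
    (\esum_(z in [set: S]) ((p x z)%:E * transition_iter p m' z y))%E
  else ((x == y)%:R)%:E.

(* Since 1 - ||B|| is at most 1, log (1 - ||B||)^-1 is finite exactly when
   ||B|| < 1. *)
Definition cond_C1 (K : realType) (d : nat) (P Q R : nat -> 'M[K]_d) : Prop :=
  forall n, (0 < n)%N -> row_norm (R n + P n) < 1 /\ row_norm (R n + Q n) < 1.

Definition cond_C2 (K : realType) (d : nat) (P Q : nat -> 'M[K]_d) : Prop :=
  (forall n j, 0 < \sum_i P n i j) /\
  (forall n j, (0 < n)%N -> 0 < \sum_i Q n i j).

Definition cond_C3 (K : realType) (d : nat) (P Q R : nat -> 'M[K]_d) : Prop :=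
  forall i j : 'I_d, exists m : nat,
    (0 < transition_iter (transition P Q R) m (0%N, i) (0%N, j))%E.

(* Under the law Pr, X is a Markov chain on the countable discrete space S with
   initial distribution nu and transition probabilities p.  The Markov property
   is given in product form, so no conditioning on null events occurs. *)
Definition markov_chain (K : realType) (dsp : measure_display)
    (Omega : measurableType dsp) (Pr : probability Omega K) (S : Type)
    (X : nat -> Omega -> S) (nu : S -> K) (p : S -> S -> K) : Prop :=
  [/\ forall n s, measurable (X n @^-1` [set s]),
      forall s, Pr (X 0%N @^-1` [set s]) = (nu s)%:E
    & forall (n : nat) (s : nat -> S),
        Pr [set w | forall k, (k <= n.+1)%N -> X k w = s k] =
        (Pr [set w | forall k, (k <= n)%N -> X k w = s k] *
         (p (s n) (s n.+1))%:E)%E].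

Definition point_init (K : realType) (d : nat) (x : strip d) : strip d -> K :=
  fun y => (y == x)%:R.

Definition layer0_init (K : realType) (d : nat) (mu : 'I_d -> K) :
    strip d -> K :=
  fun x => if x.1 == 0%N then mu x.2 else 0.

Definition prob_vector (K : realType) (d : nat) (mu : 'I_d -> K) : Prop :=
  (forall i, 0 <= mu i) /\ \sum_i mu i = 1.

(* T_y^+; equal to +oo on trajectories that never visit layer y at a time
   t >= 1. *)
Definition return_time (K : realType) (d : nat) (Omega : Type)
    (X : nat -> Omega -> strip d) (y : nat) (w : Omega) : \bar K :=
  ereal_inf [set (t%:R)%:E | t in [set t : nat | (0 < t)%N /\ layer y (X t w)]].

(* Pr x is the law under which the walk X starts at x. *)
Definition layer_positive_recurrent (K : realType) (d : nat)
    (dsp : measure_display) (Omega : measurableType dsp)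
    (Pr : strip d -> probability Omega K) (X : nat -> Omega -> strip d)
    (y : nat) : Prop :=
  forall x, layer y x ->
    (\int[Pr x]_(w in [set: Omega]) return_time K X y w < +oo)%E.

Definition positive_recurrent (K : realType) (d : nat)
    (dsp : measure_display) (Omega : measurableType dsp)
    (Pr : strip d -> probability Omega K) (X : nat -> Omega -> strip d) : Prop :=
  forall y, layer_positive_recurrent Pr X y.

(* zeta_gap P Q R rho k n is zeta^-_{n,n+k}; the recursion is on the distance k
   to the upper layer. *)
Fixpoint zeta_gap (K : realType) (d : nat) (P Q R : nat -> 'M[K]_d)
    (rho : 'M[K]_d) (k n : nat) : 'M[K]_d :=
  if k is k'.+1 then
    invmx (1%:M - P n *m zeta_gap P Q R rho k' n.+1 - R n) *m Q n
  else rho.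

(* zeta^-_{n,a}, meaningful for 1 <= n <= a. *)
Definition zeta_trunc (K : realType) (d : nat) (P Q R : nat -> 'M[K]_d)
    (rho : 'M[K]_d) (n a : nat) : 'M[K]_d :=
  zeta_gap P Q R rho (a - n) n.

Lemma zeta_trunc_diag (K : realType) (d : nat) (P Q R : nat -> 'M[K]_d)
    (rho : 'M[K]_d) (a : nat) : zeta_trunc P Q R rho a a = rho.
Proof. by rewrite /zeta_trunc subnn. Qed.

Lemma zeta_trunc_rec (K : realType) (d : nat) (P Q R : nat -> 'M[K]_d)
    (rho : 'M[K]_d) (n a : nat) : (n < a)%N ->
  zeta_trunc P Q R rho n a =
  invmx (1%:M - P n *m zeta_trunc P Q R rho n.+1 a - R n) *m Q n.
Proof. by move=> ltna; rewrite /zeta_trunc -(subnSK ltna). Qed.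

Definition zeta (K : realType) (d : nat) (P Q R : nat -> 'M[K]_d)
    (rho : 'M[K]_d) (n : nat) : 'M[K]_d :=
  lim (zeta_trunc P Q R rho n a @[a --> \oo]).

Definition A_mx (K : realType) (d : nat) (P Q R : nat -> 'M[K]_d)
    (rho : 'M[K]_d) (n : nat) : 'M[K]_d :=
  invmx (1%:M - P n *m zeta P Q R rho n.+1 - R n) *m P n.

Definition u_vec (K : realType) (d : nat) (P Q R : nat -> 'M[K]_d)
    (rho : 'M[K]_d) (n : nat) : 'cV[K]_d :=
  invmx (1%:M - P n *m zeta P Q R rho n.+1 - R n) *m const_mx 1.

(* Coordinate j of the series sum_(k >= 1) A_1 ... A_(k-1) u_k. *)
Definition Au_series (K : realType) (d : nat) (P Q R : nat -> 'M[K]_d)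
    (rho : 'M[K]_d) (j : 'I_d) : \bar K :=
  (\sum_(1 <= k <oo)
     ((((\big[mulmx/1%:M]_(1 <= m < k) A_mx P Q R rho m)
        *m u_vec P Q R rho k) j 0)%:E))%E.

(* The coordinates of the series may be +oo, so its product with the row vector
   1' P_0 is expanded in \bar K. *)
Definition varrho (K : realType) (d : nat) (P Q R : nat -> 'M[K]_d)
    (rho : 'M[K]_d) : \bar K :=
  (\sum_(j < d) (((const_mx 1 : 'rV[K]_d) *m P 0%N) 0 j)%:E
                * Au_series P Q R rho j + (d%:R)%:E)%E.

(* Main.v *)
Require Import Defs.
From mathcomp Require Import all_boot all_order all_algebra.
From mathcomp Require Import all_classical all_reals all_analysis.
From mathcomp Require Import ring lra.
Import Order.TTheory GRing.Theory Num.Theory.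
Import numFieldTopology.Exports numFieldNormedType.Exports.
Local Open Scope classical_set_scope.
Local Open Scope ring_scope.

Set Implicit Arguments.
Unset Strict Implicit.
Unset Printing Implicit Defensive.

(* For n >= 1 the matrix B_n = P_n zeta_{n+1} + R_n is nonnegative with row sums
   below 1, so (I - B_n) X >= 0 implies X >= 0, and
   (I - B_n) zeta_n = Q_n, (I - B_n) A_n = P_n, (I - B_n) u_n = 1.

   Let h_n be the vector of mean hitting times of layer 0 from layer n.  The
   probabilities s_t(n) of avoiding layer 0 up to time t satisfy
   s_t(n) >= zeta_n s_t(n-1), by induction on t since s_t decreases in t.
   Summing over t, D_n = h_n - zeta_n h_{n-1} >= 0; first-step analysis gives
   D_n = u_n + A_n D_{n+1}, so the series is bounded by D_1 whenever h_1 is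
   finite.

   Conversely, if h_n = sum_{k >= n} A_n ... A_{k-1} u_k is finite, the recursion
   V_n = h_n + zeta_n V_{n-1} above layer y, started from V_y = 0 and continued
   below y by constants on each layer, defines a function with V = 1 + step V
   above y and V >= 1 + step V below y: a Lyapunov function bounding the mean
   hitting times of layer y. *)

(** * Entrywise order and entrywise limits of matrices *)

Section EntrywiseOrder.
Context {K : realType}.

Definition lemx m n (A B : 'M[K]_(m, n)) : Prop := forall i j, A i j <= B i j.

Lemma lemx_refl m n (A : 'M[K]_(m, n)) : lemx A A.
Proof. by []. Qed.

Lemma lemx_trans m n (B A C : 'M[K]_(m, n)) : lemx A B -> lemx B C -> lemx A C.
Proof. by move=> AB BC i j; exact: le_trans (AB i j) (BC i j). Qed.

Lemma lemxD m n (A B C D : 'M[K]_(m, n)) :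
  lemx A B -> lemx C D -> lemx (A + C) (B + D).
Proof. by move=> AB CD i j; rewrite !mxE lerD. Qed.

Lemma subemx_ge0 m n (A B : 'M[K]_(m, n)) : lemx 0 (B - A) <-> lemx A B.
Proof.
by split=> h i j; have := h i j; rewrite !mxE subr_ge0.
Qed.

Lemma lemx_pmul2l m n k (A : 'M[K]_(m, n)) (B C : 'M[K]_(n, k)) :
  lemx 0 A -> lemx B C -> lemx (A *m B) (A *m C).
Proof.
move=> A0 BC i j; rewrite !mxE; apply: ler_sum => l _.
by apply: ler_wpM2l (BC _ _); have := A0 i l; rewrite mxE.
Qed.

Lemma mulmx_ge0 m n k (A : 'M[K]_(m, n)) (B : 'M[K]_(n, k)) :
  lemx 0 A -> lemx 0 B -> lemx 0 (A *m B).
Proof. by move=> A0 B0; have := lemx_pmul2l A0 B0; rewrite mulmx0. Qed.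

Lemma addmx_ge0 m n (A B : 'M[K]_(m, n)) :
  lemx 0 A -> lemx 0 B -> lemx 0 (A + B).
Proof. by move=> A0 B0; have := lemxD A0 B0; rewrite addr0. Qed.

Lemma const_mx_ge0 m n (c : K) : 0 <= c -> lemx 0 (const_mx c : 'M[K]_(m, n)).
Proof. by move=> c0 i j; rewrite !mxE. Qed.

(** Summing the rows of [M *m v t] bounds each coordinate of [v t] times its column sum in [M]. With
    [cond_C2] this carries bounds from a layer to the next one up. *)
Lemma lemx_col_pos_bound d (M : 'M[K]_d) (v : nat -> 'cV[K]_d) (C : 'cV[K]_d) :
  lemx 0 M -> (forall j, 0 < \sum_i M i j) -> (forall t, lemx 0 (v t)) ->
  (forall t, lemx (M *m v t) C) -> exists C', forall t, lemx (v t) C'.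
Proof.
move=> M0 Mpos v0 vC.
exists (\col_j ((\sum_i C i 0) / \sum_i M i j)) => t j k.
rewrite !mxE ord1 ler_pdivlMr// mulrC mulr_suml; apply: ler_sum => i _.
apply: le_trans (vC t i 0); rewrite mxE (bigD1 j)//= lerDl sumr_ge0// => l _.
by apply: mulr_ge0; [have := M0 i l|have := v0 t l 0]; rewrite mxE.
Qed.

Definition mx_cvg m n (v : nat -> 'M[K]_(m, n)) (l : 'M[K]_(m, n)) : Prop :=
  forall i j, v t i j @[t --> \oo] --> l i j.

Lemma mx_cvg_cst m n (l : 'M[K]_(m, n)) : mx_cvg (fun=> l) l.
Proof. by move=> i j; exact: cvg_cst. Qed.

Lemma mx_cvgD m n (u v : nat -> 'M[K]_(m, n)) a b :
  mx_cvg u a -> mx_cvg v b -> mx_cvg (fun t => u t + v t) (a + b).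
Proof.
move=> ua vb i j; rewrite mxE; under eq_fun do rewrite mxE.
exact: cvgD (ua i j) (vb i j).
Qed.

Lemma mx_cvgN m n (u : nat -> 'M[K]_(m, n)) a :
  mx_cvg u a -> mx_cvg (fun t => - u t) (- a).
Proof.
move=> ua i j; rewrite mxE; under eq_fun do rewrite mxE.
exact: cvgN (ua i j).
Qed.

Lemma mx_cvgM m n k (u : nat -> 'M[K]_(m, n)) (v : nat -> 'M[K]_(n, k)) a b :
  mx_cvg u a -> mx_cvg v b -> mx_cvg (fun t => u t *m v t) (a *m b).
Proof.
move=> ua vb i j; rewrite mxE; under eq_fun do rewrite mxE.
by apply: cvg_big => [|l _]; [exact: add_continuous|apply: cvgM; [exact: ua|exact: vb]].
Qed.

Lemma mx_cvg_shift m n (u : nat -> 'M[K]_(m, n)) a :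
  mx_cvg u a -> mx_cvg (fun t => u t.+1) a.
Proof.
by move=> ua i j; have := ua i j; rewrite -(cvg_shiftS (fun t => u t i j)).
Qed.

Lemma mx_cvg_unique m n (u : nat -> 'M[K]_(m, n)) a b :
  mx_cvg u a -> mx_cvg u b -> a = b.
Proof.
by move=> ua ub; apply/matrixP => i j; exact: cvg_unique (ua i j) (ub i j).
Qed.

Lemma mx_cvg_le m n (u v : nat -> 'M[K]_(m, n)) a b :
  mx_cvg u a -> mx_cvg v b -> (forall t, lemx (u t) (v t)) -> lemx a b.
Proof.
move=> ua vb uv i j; apply: (ler_cvg_to (ua i j) (vb i j)).
by apply: nearW => t; exact: uv.
Qed.

Lemma mx_monotone_cvg m n (u : nat -> 'M[K]_(m, n)) C :
  (forall t, lemx (u t) (u t.+1)) -> (forall t, lemx (u t) C) ->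
  exists l, mx_cvg u l /\ forall t, lemx (u t) l.
Proof.
move=> inc ub.
have nd i j : nondecreasing_seq (fun t => u t i j).
  by apply/nondecreasing_seqP => t; exact: inc.
have cv i j : cvgn (fun t => u t i j).
  apply: nondecreasing_is_cvgn (nd i j) _.
  by exists (C i j) => _ [t _ <-]; exact: ub.
exists (\matrix_(i, j) limn (fun t => u t i j)); split=> [i j|t i j].
  by rewrite mxE; exact: cv.
by rewrite mxE; exact: nondecreasing_cvgn_le.
Qed.

End EntrywiseOrder.

Arguments mx_cvg_cst {K m n} l.

(** * Resolvents of nonnegative matrices with row sums below 1 *)

Section SubstochasticResolvent.
Context {K : realType} {d : nat} (B : 'M[K]_d).
Hypothesis B0 : lemx 0 B.
Hypothesis B1 : forall i, \sum_j B i j < 1.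

(* At an index where a column of [X] is minimal, [X = B X + nonnegative] forces
   the minimum to be nonnegative, because the row sums of [B] are below 1. *)
Lemma resolvent_ge0 n (X : 'M[K]_(d, n)) :
  lemx 0 ((1%:M - B) *m X) -> lemx 0 X.
Proof.
move=> h i0 k; rewrite mxE.
case: (arg_minP (fun i => X i k) (erefl true : xpredT i0)) => i _ imin.
apply: le_trans (imin i0 isT); rewrite leNgt; apply/negP => Xneg.
have := h i k; rewrite mulmxBl mul1mx !mxE subr_ge0; apply/negP; rewrite -ltNge.
apply: (@lt_le_trans _ _ ((\sum_j B i j) * X i k)).
  by rewrite -{1}[X i k]mul1r ltr_nM2r.
rewrite mulr_suml; apply: ler_sum => j _; apply: ler_wpM2l; last exact: imin.
by have := B0 i j; rewrite mxE.
Qed.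

(** Applying [resolvent_ge0] to [X] and to [- X] shows that the kernel is trivial; no Neumann series
    is summed. *)
Lemma resolvent_unit : (1%:M - B) \in unitmx.
Proof.
have inj (X : 'cV[K]_d) : (1%:M - B) *m X = 0 -> X = 0.
  move=> X0; apply/matrixP => i j; apply/eqP; rewrite eq_le.
  have h1 : lemx 0 X by apply: resolvent_ge0; rewrite X0.
  have h2 : lemx 0 (- X) by apply: resolvent_ge0; rewrite mulmxN X0 oppr0.
  by have := h1 i j; have := h2 i j; rewrite !mxE oppr_ge0 => -> ->.
rewrite -unitmx_tr -row_free_unit; apply/inj_row_free => v v0.
apply: trmx_inj; rewrite trmx0; apply: inj.
by rewrite -[_ *m _]trmxK trmx_mul trmxK v0 trmx0.
Qed.

Lemma resolvent_le n (X Y : 'M[K]_(d, n)) :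
  lemx ((1%:M - B) *m X) ((1%:M - B) *m Y) -> lemx X Y.
Proof.
by move=> /subemx_ge0; rewrite -mulmxBr => /resolvent_ge0 /subemx_ge0.
Qed.

Lemma resolvent_eq n (X Y : 'M[K]_(d, n)) :
  (1%:M - B) *m X = Y -> X = invmx (1%:M - B) *m Y.
Proof. by move=> <-; rewrite mulKmx// resolvent_unit. Qed.

End SubstochasticResolvent.

(** * One-step operator, avoidance probabilities and truncated hitting times *)

Section ReflectingWalk.
Context {K : realType} {d : nat}.

Let ones : 'cV[K]_d := const_mx 1.

Lemma row_sumE (M : 'M[K]_d) i : \sum_j M i j = (M *m ones) i 0.
Proof. by rewrite mxE; apply: eq_bigr => j _; rewrite mxE mulr1. Qed.

Lemma stochasticE (M : 'M[K]_d) :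
  stochastic M <-> lemx 0 M /\ M *m ones = ones.
Proof.
split=> [[M0 M1]|[M0 M1]]; split.
- by move=> i j; rewrite mxE.
- by apply/matrixP => i j; rewrite ord1 -row_sumE M1 mxE.
- by move=> i j; have := M0 i j; rewrite mxE.
- by move=> i; rewrite row_sumE M1 mxE.
Qed.

Lemma row_sum_le_norm (M : 'M[K]_d) i : \sum_j M i j <= row_norm M.
Proof.
apply: le_trans (ler_sum _ (fun j _ => ler_norm (M i j))) _.
exact: (@le_bigmax _ _ _ _ (fun i => \sum_j `|M i j|)).
Qed.

Context (P Q R : nat -> 'M[K]_d).

(** The transition operator of the walk, acting on functions on the strip stored as one column
    vector per layer. *)
Definition step (f : nat -> 'cV[K]_d) (n : nat) : 'cV[K]_d :=
  if n is m.+1 then P n *m f n.+1 + R n *m f n + Q n *m f m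
  else P 0%N *m f 1%N.

(* [surv y t n] is the vector of probabilities that the walk started in layer
   [n] avoids layer [y] at the times [0, ..., t]; [hit y t n] is the vector of
   expected values of the minimum of [t] and the first time in layer [y]. *)
Fixpoint surv (y t n : nat) : 'cV[K]_d :=
  if n == y then 0 else if t is t'.+1 then step (surv y t') n else ones.

Definition hit (y t n : nat) : 'cV[K]_d := \sum_(u < t) surv y u n.

Lemma surv0 y n : surv y 0 n = if n == y then 0 else ones.
Proof. by []. Qed.

Lemma survS y t n : surv y t.+1 n = if n == y then 0 else step (surv y t) n.
Proof. by []. Qed.

Lemma surv_at y t : surv y t y = 0.
Proof. by case: t => [|t]; rewrite (surv0, survS) eqxx. Qed.

Lemma hit_at y t : hit y t y = 0.
Proof. by rewrite /hit big1// => u _; exact: surv_at. Qed.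

Hypothesis hPQR : block_transitions P Q R.

Lemma P_ge0 n : lemx 0 (P n).
Proof. by case: hPQR => h _ _ _ i j; rewrite mxE. Qed.

Lemma Q_ge0 n : (0 < n)%N -> lemx 0 (Q n).
Proof. by case: hPQR => _ h _ _ n0 i j; rewrite mxE; case: (h n i j n0). Qed.

Lemma R_ge0 n : (0 < n)%N -> lemx 0 (R n).
Proof. by case: hPQR => _ h _ _ n0 i j; rewrite mxE; case: (h n i j n0). Qed.

Lemma P0_ones : P 0%N *m ones = ones.
Proof. by case: hPQR. Qed.

Lemma PQR_ones n : (0 < n)%N -> P n *m ones + Q n *m ones + R n *m ones = ones.
Proof. by case: hPQR => _ _ _ h n0; rewrite -!mulmxDl h. Qed.

Hint Resolve P_ge0 lemx_refl : core.

Lemma step_le f g n : (forall m, (m <= n.+1)%N -> lemx (f m) (g m)) ->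
  lemx (step f n) (step g n).
Proof.
case: n => [|n] fg /=; first by apply: lemx_pmul2l => //; exact: fg.
apply: lemxD; first apply: lemxD; apply: lemx_pmul2l; do ?exact: fg.
- exact: P_ge0.
- exact: R_ge0.
- exact: Q_ge0.
- by apply: fg; rewrite leqW.
Qed.

Lemma step_cst c n : step (fun=> const_mx c) n = const_mx c.
Proof.
have -> : const_mx c = c *: ones by apply/matrixP => i j; rewrite !mxE mulr1.
case: n => [|n] /=; first by rewrite -scalemxAr P0_ones.
by rewrite -!scalemxAr -!scalerDr addrAC PQR_ones.
Qed.

Lemma step_ge0 f n : (forall m, lemx 0 (f m)) -> lemx 0 (step f n).
Proof.
move=> f0; have <- : step (fun=> 0) n = 0 := step_cst 0 n.
by apply: step_le.
Qed.

Lemma step_sum (f : nat -> nat -> 'cV[K]_d) t n :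
  step (fun m => \sum_(u < t) f u m) n = \sum_(u < t) step (f u) n.
Proof.
case: n => [|n] /=; first by rewrite mulmx_sumr.
by rewrite !mulmx_sumr !big_split.
Qed.

Lemma surv_ge0 y t n : lemx 0 (surv y t n).
Proof.
elim: t n => [|t IH] n; rewrite (surv0, survS); case: eqP => // _.
  exact: const_mx_ge0.
exact: step_ge0.
Qed.

Lemma surv_anti y t n : lemx (surv y t.+1 n) (surv y t n).
Proof.
elim: t n => [|t IH] n; rewrite [X in lemx X _]survS (surv0, survS);
  case: eqP => // _; last exact: step_le.
rewrite -[X in lemx _ X](step_cst 1 n).
by apply: step_le => m _; rewrite surv0; case: eqP => // _; exact: const_mx_ge0.
Qed.

Lemma hit_ge0 y t n : lemx 0 (hit y t n).
Proof.
elim: t => [|t IH]; rewrite /hit ?big_ord0// big_ord_recr/=.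
by apply: addmx_ge0 => //; exact: surv_ge0.
Qed.

Lemma hit_nondecreasing y t n : lemx (hit y t n) (hit y t.+1 n).
Proof.
rewrite /hit big_ord_recr/= -[X in lemx X _]addr0.
by apply: lemxD (lemx_refl _) _; exact: surv_ge0.
Qed.

Lemma hitS y t n :
  hit y t.+1 n = if n == y then 0 else ones + step (hit y t) n.
Proof.
case: eqP => [->|/eqP/negPf ny]; first exact: hit_at.
rewrite /hit big_ord_recl/= ny step_sum; congr (_ + _).
Qed.

(** Minimality of hitting times: [hit] starts at 0 and satisfies the recursion [hitS] with equality,
    so monotonicity of [step] gives the bound by induction on [t]. *)
Lemma hit_le_supersolution y (V : nat -> 'cV[K]_d) : (forall n, lemx 0 (V n)) ->
  (forall n, n != y -> lemx (ones + step V n) (V n)) ->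
  forall t n, lemx (hit y t n) (V n).
Proof.
move=> V0 VS; elim=> [|t IH] n; first by rewrite /hit big_ord0.
rewrite hitS; case: eqP => [_|/eqP ny]; first exact: V0.
by apply: lemx_trans (VS n ny); apply: lemxD => //; apply: step_le.
Qed.

(** * The matrices [zeta]: stochasticity and the limiting equation *)

Hypothesis hC1 : cond_C1 P Q R.
Variable rho : 'M[K]_d.
Hypothesis hrho : stochastic rho.

Let gap := zeta_gap P Q R rho.

Lemma up_kernel_ge0 n (Z : 'M[K]_d) : (0 < n)%N -> stochastic Z ->
  lemx 0 (P n *m Z + R n).
Proof.
by move=> n0 /stochasticE[Z0 _]; apply: addmx_ge0; [exact: mulmx_ge0|exact: R_ge0].
Qed.

(** Since [Z] has row sums 1, [P n *m Z + R n] has the same row sums as [R n + P n], which [cond_C1]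
    keeps below 1. *)
Lemma up_kernel_lt1 n (Z : 'M[K]_d) i : (0 < n)%N -> stochastic Z ->
  \sum_j (P n *m Z + R n) i j < 1.
Proof.
move=> n0 /stochasticE[_ Z1]; have [h _] := hC1 n0; apply: le_lt_trans h.
apply: le_trans (row_sum_le_norm _ i).
by rewrite !row_sumE !mulmxDl -mulmxA Z1 addrC.
Qed.

Lemma up_kernelE n (Z : 'M[K]_d) :
  1%:M - P n *m Z - R n = 1%:M - (P n *m Z + R n).
Proof. by rewrite opprD addrA. Qed.

Lemma up_resolvent_ones n (Z : 'M[K]_d) : (0 < n)%N -> stochastic Z ->
  (1%:M - (P n *m Z + R n)) *m ones = Q n *m ones.
Proof.
move=> n0 /stochasticE[_ Z1]; rewrite mulmxBl mulmxDl mul1mx -mulmxA Z1.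
by apply/eqP; rewrite subr_eq addrA [_ + P n *m _]addrC PQR_ones.
Qed.

Let gapS k n : gap k.+1 n =
  invmx (1%:M - (P n *m gap k n.+1 + R n)) *m Q n.
Proof. by rewrite -up_kernelE. Qed.

Lemma zeta_gap_stochastic k n : (0 < n)%N -> stochastic (gap k n).
Proof.
elim: k n => [|k IH] n n0 //=; have s := IH n.+1 isT.
apply/stochasticE; rewrite gapS.
have u0 := up_kernel_ge0 n0 s; have u1 i := up_kernel_lt1 i n0 s.
split; last first.
  by rewrite -mulmxA -(up_resolvent_ones n0 s) mulKmx// resolvent_unit.
apply: (resolvent_ge0 u0 u1); rewrite mulKVmx ?resolvent_unit//.
exact: Q_ge0.
Qed.

Lemma zeta_gap_eq k n : (0 < n)%N ->
  (1%:M - (P n *m gap k n.+1 + R n)) *m gap k.+1 n = Q n.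
Proof.
move=> n0; have s := zeta_gap_stochastic k (ltn0Sn n).
rewrite gapS mulKVmx//.
by apply: resolvent_unit; [exact: up_kernel_ge0|move=> i; exact: up_kernel_lt1].
Qed.

Hypothesis hzeta : forall n : nat, (0 < n)%N ->
  cvg (zeta_trunc P Q R rho n a @[a --> \oo]).

Let zet := zeta P Q R rho.

Lemma zeta_gap_cvg n : (0 < n)%N -> mx_cvg (fun k => gap k n) (zet n).
Proof.
move=> n0 i j.
have h : zeta_trunc P Q R rho n a i j @[a --> \oo] --> zet n i j.
  exact: (cvg_comp _ _ (hzeta n0) (@coord_continuous _ _ _ i j _)).
move: h; rewrite -(cvg_shiftn n).
(* At [a = k + n] the distance [a - n] is exactly [k]. *)
by under eq_fun do rewrite /zeta_trunc addnK.
Qed.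

Lemma zeta_stochastic n : (0 < n)%N -> stochastic (zet n).
Proof.
move=> n0; apply/stochasticE; split.
  refine (mx_cvg_le (mx_cvg_cst 0) (zeta_gap_cvg n0) _) => k.
  by have /stochasticE[] := zeta_gap_stochastic k n0.
apply: (mx_cvg_unique (mx_cvgM (zeta_gap_cvg n0) (mx_cvg_cst ones))).
have -> : (fun k => gap k n *m ones) = (fun=> ones).
  by apply/funext => k; have /stochasticE[] := zeta_gap_stochastic k n0.
exact: mx_cvg_cst.
Qed.

Let B n := P n *m zet n.+1 + R n.

(** The recursion is passed to the limit in multiplied form, which takes only limits of sums and
    products and avoids continuity of matrix inversion. *)
Lemma zeta_eq n : (0 < n)%N -> (1%:M - B n) *m zet n = Q n.
Proof.
move=> n0; have c : mx_cvg
    (fun k => (1%:M - (P n *m gap k n.+1 + R n)) *m gap k.+1 n)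
    ((1%:M - B n) *m zet n).
  apply: mx_cvgM; last exact: (mx_cvg_shift (zeta_gap_cvg n0)).
  apply: mx_cvgD (mx_cvg_cst _) _; apply: mx_cvgN.
  apply: mx_cvgD (mx_cvg_cst _); apply: mx_cvgM (mx_cvg_cst _) _.
  exact: zeta_gap_cvg.
apply: (mx_cvg_unique c).
under eq_fun do rewrite (zeta_gap_eq _ n0).
exact: mx_cvg_cst.
Qed.

Lemma B_ge0 n : (0 < n)%N -> lemx 0 (B n).
Proof. by move=> n0; apply: up_kernel_ge0 => //; exact: zeta_stochastic. Qed.

Lemma B_lt1 n i : (0 < n)%N -> \sum_j B n i j < 1.
Proof. by move=> n0; apply: up_kernel_lt1 => //; exact: zeta_stochastic. Qed.

Lemma zeta_ge0 n : (0 < n)%N -> lemx 0 (zet n).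
Proof. by move=> /zeta_stochastic /stochasticE[]. Qed.

(** * The matrices [A], the vectors [u] and the partial sums of the series *)

Let A := A_mx P Q R rho.
Let u := u_vec P Q R rho.

Lemma A_eq n : (0 < n)%N -> (1%:M - B n) *m A n = P n.
Proof.
move=> n0; rewrite /A /A_mx up_kernelE mulKVmx// resolvent_unit//.
  exact: B_ge0.
by move=> i; exact: B_lt1.
Qed.

Lemma u_eq n : (0 < n)%N -> (1%:M - B n) *m u n = ones.
Proof.
move=> n0; rewrite /u /u_vec up_kernelE mulKVmx// resolvent_unit//.
  exact: B_ge0.
by move=> i; exact: B_lt1.
Qed.

Lemma B_resolvent_ge0 n k (X : 'M[K]_(d, k)) : (0 < n)%N ->
  lemx 0 ((1%:M - B n) *m X) -> lemx 0 X.
Proof.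
move=> n0; apply: resolvent_ge0; first exact: B_ge0.
by move=> i; exact: B_lt1.
Qed.

Lemma B_resolvent_le n k (X Y : 'M[K]_(d, k)) : (0 < n)%N ->
  lemx ((1%:M - B n) *m X) ((1%:M - B n) *m Y) -> lemx X Y.
Proof.
move=> n0; apply: resolvent_le; first exact: B_ge0.
by move=> i; exact: B_lt1.
Qed.

Lemma A_ge0 n : (0 < n)%N -> lemx 0 (A n).
Proof. by move=> n0; apply: (B_resolvent_ge0 n0); rewrite A_eq. Qed.

Lemma u_ge0 n : (0 < n)%N -> lemx 0 (u n).
Proof.
by move=> n0; apply: (B_resolvent_ge0 n0); rewrite u_eq//; exact: const_mx_ge0.
Qed.

Lemma u_A_eq n (X Y : 'cV[K]_d) :
  (1%:M - B n.+1) *m X = ones + P n.+1 *m Y -> X = u n.+1 + A n.+1 *m Y.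
Proof.
move=> /resolvent_eq ->; first last.
- by move=> i; exact: B_lt1.
- exact: B_ge0.
by rewrite mulmxDr mulmxA /u /A /u_vec /A_mx !up_kernelE.
Qed.

(** Multiplied by [1%:M - B n], the claim reads [P n - B n *m P n <= P n]. It lets the column
    positivity of [P] serve for [A]. *)
Lemma P_le_A n : (0 < n)%N -> lemx (P n) (A n).
Proof.
move=> n0; apply: (B_resolvent_le n0); rewrite A_eq// mulmxBl mul1mx.
apply/subemx_ge0; rewrite opprB addrC subrK.
by apply: mulmx_ge0; [exact: B_ge0|].
Qed.

(** Horner form of the first [N] terms of the tail series started at layer [n]; the starting layer
    varies so that bounds and limits can move between layers. *)
Fixpoint Au_sum (N n : nat) : 'cV[K]_d :=
  if N is N'.+1 then u n + A n *m Au_sum N' n.+1 else 0.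

Lemma Au_sumE N n : Au_sum N n =
  \sum_(n <= k < n + N) (\big[mulmx/1%:M]_(n <= m < k) A m) *m u k.
Proof.
elim: N n => [|N IH] n; first by rewrite addn0 big_geq.
rewrite addnS big_ltn ?ltnS ?leq_addr// (big_geq (leqnn n)) mul1mx /= IH addSn.
congr (_ + _); rewrite mulmx_sumr !big_nat; apply: eq_bigr => k /andP[nk _].
by rewrite [in RHS]big_ltn// mulmxA.
Qed.

Lemma Au_sum_ge0 N n : (0 < n)%N -> lemx 0 (Au_sum N n).
Proof.
elim: N n => [|N IH] n n0 //=; apply: addmx_ge0; first exact: u_ge0.
by apply: mulmx_ge0; [exact: A_ge0|exact: IH].
Qed.

Lemma Au_sum_nondecreasing N n : (0 < n)%N ->
  lemx (Au_sum N n) (Au_sum N.+1 n).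
Proof.
elim: N n => [|N IH] n n0; first exact: (Au_sum_ge0 1).
apply: lemxD => //; apply: lemx_pmul2l; first exact: A_ge0.
exact: IH.
Qed.

(* By induction on [t]: the walk started from layer [n] must pass through layer
   [n - 1], which it enters with distribution [zet n]. *)
Lemma zeta_surv_le t n : lemx (zet n.+1 *m surv 0 t n) (surv 0 t n.+1).
Proof.
elim: t n => [|t IH] n.
  have /stochasticE[_ z1] := zeta_stochastic (ltn0Sn n).
  rewrite !surv0/= -[X in lemx _ X]z1; apply: lemx_pmul2l.
    exact: zeta_ge0.
  by case: eqP => // _; exact: const_mx_ge0.
apply: (B_resolvent_le (ltn0Sn n)); rewrite mulmxA zeta_eq//.
set s := surv 0 t.+1.
have sle m : lemx (s m) (surv 0 t m) by exact: surv_anti.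
(* This is the claim multiplied by [1%:M - B n.+1]. Its right side is one step of [surv 0 t], so
   [sle] and the induction hypothesis compare the terms one by one. *)
have /subemx_ge0 le : lemx
    (P n.+1 *m (zet n.+2 *m s n.+1) + R n.+1 *m s n.+1 + Q n.+1 *m s n)
    (s n.+1).
  rewrite [X in lemx _ X](_ : _ = step (surv 0 t) n.+1)//.
  apply: lemxD; last by apply: lemx_pmul2l (sle n); exact: Q_ge0.
  apply: lemxD; last by apply: lemx_pmul2l (sle n.+1); exact: R_ge0.
  apply: lemx_pmul2l => //; apply: lemx_trans (IH n.+1).
  by apply: lemx_pmul2l (sle n.+1); exact: zeta_ge0.
by apply/subemx_ge0; rewrite mulmxBl mul1mx mulmxDl -mulmxA -addrA -opprD.
Qed.

(** * Finite mean hitting times of layer 0 bound the series *)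

Hypothesis hC2 : cond_C2 P Q.

Lemma P_colsum_gt0 n j : 0 < \sum_i P n i j.
Proof. exact: hC2.1. Qed.

(** By first-step analysis [P n *m hit 0 t n.+1] is at most [hit 0 t.+1 n] for [n >= 1], and
    positive column sums of [P n] lift the bound one layer. *)
Lemma hit0_bounded C : (forall t, lemx (hit 0 t 1) C) ->
  forall n, exists C', forall t, lemx (hit 0 t n) C'.
Proof.
move=> hC; case=> [|n]; first by exists 0 => t; rewrite hit_at.
elim: n => [|n [C' IH]]; first by exists C.
apply: (@lemx_col_pos_bound _ _ (P n.+1) _ C') => // [j|t|t].
- exact: P_colsum_gt0.
- exact: hit_ge0.
- apply: lemx_trans (IH t.+1); rewrite hitS/= addrC -!addrA.
  rewrite -[X in lemx X _]addr0; apply: lemxD => //; apply: addmx_ge0.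
    by apply: mulmx_ge0; [exact: R_ge0|exact: hit_ge0].
  apply: addmx_ge0; last exact: const_mx_ge0.
  by apply: mulmx_ge0; [exact: Q_ge0|exact: hit_ge0].
Qed.

Lemma Au_sum_le_hit C : (forall t, lemx (hit 0 t 1) C) ->
  exists h, forall N, lemx (Au_sum N 1) h.
Proof.
move=> /hit0_bounded bd.
have /choice[h hE] n : exists h, mx_cvg (fun t => hit 0 t n) h.
  have [C' hC'] := bd n.
  have [|l [lE _]] := mx_monotone_cvg _ hC'; last by exists l.
  by move=> t; exact: hit_nondecreasing.
have hS n : h n.+1 = ones + step h n.+1.
  apply: (mx_cvg_unique (mx_cvg_shift (hE n.+1))).
  under eq_fun do rewrite hitS/=.
  apply: mx_cvgD (mx_cvg_cst _) _.
  by apply: mx_cvgD; [apply: mx_cvgD|]; apply: mx_cvgM (mx_cvg_cst _) (hE _).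
have hz n : lemx (zet n.+1 *m h n) (h n.+1).
  refine (mx_cvg_le (mx_cvgM (mx_cvg_cst _) (hE n)) (hE n.+1) _) => t.
  elim: t => [|t IH]; rewrite /hit ?big_ord0 ?mulmx0// !big_ord_recr/= mulmxDr.
  by apply: lemxD => //; exact: zeta_surv_le.
(* The index is shifted: [D n] belongs to layer [n.+1], so [D 0] is the bound for the series started
   at layer 1. *)
pose D n := h n.+1 - zet n.+1 *m h n.
have DE n : D n = u n.+1 + A n.+1 *m D n.+1.
  apply: u_A_eq.
  rewrite /D mulmxBr mulmxA zeta_eq// mulmxBl mul1mx {1}hS/=.
  rewrite /B mulmxDl -mulmxA mulmxBr.
  set a := P _ *m h _; set b := R _ *m _; set c := Q _ *m _; set e := P _ *m _.
  by apply/matrixP => i j; rewrite !mxE; ring.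
(* Unfolding [DE] [N] times leaves products of the [A] applied to a later [D]; this remainder is
   nonnegative by [hz] and is dropped. *)
have key N n : lemx (Au_sum N n.+1) (D n).
  elim: N n => [|N IH] n /=; first by apply/subemx_ge0; exact: hz.
  rewrite DE; apply: lemxD => //; apply: lemx_pmul2l => //; exact: A_ge0.
by exists (D 0%N) => N; exact: key.
Qed.

(** * A bounded series gives a Lyapunov function for every layer *)

(** As [P_le_A] holds and [u] is nonnegative, [P n *m Au_sum N n.+1] is at most [Au_sum N.+1 n] for
    [n >= 1]; column positivity of [P n] then moves the bound up. *)
Lemma Au_sum_bounded C : (forall N, lemx (Au_sum N 1) C) ->
  forall n, exists C', forall N, lemx (Au_sum N n.+1) C'.
Proof.
move=> hC; elim=> [|n [C' IH]]; first by exists C.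
apply: (@lemx_col_pos_bound _ _ (P n.+1) _ C') => // [j|t|t].
- exact: P_colsum_gt0.
- exact: Au_sum_ge0.
- apply: lemx_trans (IH t.+1); rewrite /= -[X in lemx X _]add0r.
  apply: lemxD; first exact: u_ge0.
  apply/subemx_ge0; rewrite -mulmxBl; apply: mulmx_ge0.
    by apply/subemx_ge0; exact: P_le_A.
  exact: Au_sum_ge0.
Qed.

Lemma Au_tail_exists C : (forall N, lemx (Au_sum N 1) C) ->
  exists h, (forall n, lemx 0 (h n.+1)) /\
    forall n, (1%:M - B n.+1) *m h n.+1 = ones + P n.+1 *m h n.+2.
Proof.
move=> /Au_sum_bounded bd.
have /choice[h hE] n : exists h, mx_cvg (fun N => Au_sum N n.+1) h.
  have [C' hC'] := bd n.
  have [|l [lE _]] := mx_monotone_cvg _ hC'; last by exists l.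
  by move=> N; exact: Au_sum_nondecreasing.
(* The limit [h n] is the tail from layer [n.+1]; the predecessor realigns it with layers, and the
   value at 0 is a dummy. *)
exists (fun n => h n.-1); split=> n /=.
  by refine (mx_cvg_le (mx_cvg_cst 0) (hE n) _) => N; exact: Au_sum_ge0.
have -> : h n = u n.+1 + A n.+1 *m h n.+1.
  apply: (mx_cvg_unique (mx_cvg_shift (hE n))) => /=.
  exact: mx_cvgD (mx_cvg_cst _) (mx_cvgM (mx_cvg_cst _) (hE n.+1)).
by rewrite mulmxDr (mulmxA _ (A n.+1)) A_eq// u_eq.
Qed.

(* From layer [n.+1] the walk moves up with probability at least
   [1 - row_norm (R n.+1 + Q n.+1)], so with these increments [height y] decreases
   by at least 1 in mean at every step from a layer below [y]. *)
Fixpoint slope (n : nat) : K :=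
  if n is n'.+1 then (1 + slope n') / (1 - row_norm (R n + Q n)) else 1.

Definition height (y n : nat) : K := \sum_(n <= k < y) slope k.

Lemma slope_ge0 n : 0 <= slope n.
Proof.
elim: n => [|n IH] //=; apply: divr_ge0; first exact: addr_ge0.
by rewrite subr_ge0 ltW//; exact: (hC1 (ltn0Sn n)).2.
Qed.

Lemma height_ge0 y n : 0 <= height y n.
Proof. by apply: sumr_ge0 => k _; exact: slope_ge0. Qed.

Lemma heightE y n : (n < y)%N -> height y n = slope n + height y n.+1.
Proof. by move=> ny; rewrite /height big_ltn. Qed.

(** At layer [n.+1], with masses [q] down and [r] staying, the claim reduces to [1 + q * slope n <=
    slope n.+1 * (1 - q - r)]. It holds because [q <= 1], [q + r] is at most the norm, and
    [slope n.+1] times 1 minus that norm is [1 + slope n]. *)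
Lemma height_supersolution y n : (n < y)%N ->
  lemx (ones + step (fun m => const_mx (height y m)) n) (const_mx (height y n)).
Proof.
have cE c : const_mx c = c *: ones.
  by apply/matrixP => i j; rewrite !mxE mulr1.
case: n => [|n] ny /=.
  rewrite (heightE ny) (cE (height y 1)) (cE (_ + _)) -scalemxAr P0_ones scalerDl.
  by rewrite /= scale1r.
rewrite (cE (height y n.+2)) (cE (height y n.+1)) (cE (height y n)) -!scalemxAr.
set p := P _ *m _; set r := R _ *m _; set q := Q _ *m _.
have pqr : p + q + r = ones by exact: PQR_ones.
have qrE : (R n.+1 + Q n.+1) *m ones = q + r by rewrite mulmxDl addrC.
have q0 : lemx 0 q by apply: mulmx_ge0; [exact: Q_ge0|exact: const_mx_ge0].
have r0 : lemx 0 r by apply: mulmx_ge0; [exact: R_ge0|exact: const_mx_ge0].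
clearbody p q r.
rewrite (heightE ny) (heightE (ltnW ny)) (heightE ny).
have [_ lt1] := hC1 (ltn0Sn n).
have sE : slope n.+1 * (1 - row_norm (R n.+1 + Q n.+1)) = 1 + slope n.
  by rewrite /= divfK// subr_eq0 gt_eqF.
move: (height y n.+2) (slope n.+1) (slope_ge0 n.+1) sE => c s s0 sE i j.
have qr : q i j + r i j <= row_norm (R n.+1 + Q n.+1).
  by apply: le_trans (row_sum_le_norm _ i); rewrite row_sumE qrE mxE ord1.
move: (q0 i j) (r0 i j); rewrite mxE => q0' r0'.
have pE : p i j = 1 - q i j - r i j.
  by have := congr1 (fun M : 'cV[K]_d => M i j) pqr; rewrite /ones !mxE => <-; ring.
have := slope_ge0 n; move: (slope n) sE => s' sE s'0.
rewrite /ones !mxE pE !mulr1.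
have q1 : q i j <= 1 by lra.
have := ler_wpM2l s0 qr; have := ler_wpM2l s'0 q1.
move: sE; nra.
Qed.

Section Lyapunov.
Variables (h : nat -> 'cV[K]_d) (y : nat).
Hypothesis h0 : forall n, lemx 0 (h n.+1).
Hypothesis hE : forall n,
  (1%:M - B n.+1) *m h n.+1 = ones + P n.+1 *m h n.+2.

(** The test selects the layers strictly above [y]; on layer [y] itself the value is the empty sum
    [height y y], that is 0. *)
Fixpoint lyapunov (n : nat) : 'cV[K]_d :=
  if n is n'.+1 then
    if (y <= n')%N then h n + zet n *m lyapunov n' else const_mx (height y n)
  else const_mx (height y 0).

Lemma lyapunov_low n : (n <= y)%N -> lyapunov n = const_mx (height y n).
Proof. by case: n => //= n ny; rewrite leqNgt ny. Qed.

Lemma lyapunov_high n : (y <= n)%N ->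
  lyapunov n.+1 = h n.+1 + zet n.+1 *m lyapunov n.
Proof. by move=> /= ->. Qed.

Lemma lyapunov_ge0 n : lemx 0 (lyapunov n).
Proof.
elim: n => [|n IH] /=; first exact/const_mx_ge0/height_ge0.
case: ifP => _; last exact/const_mx_ge0/height_ge0.
by apply: addmx_ge0 => //; apply: mulmx_ge0 => //; exact: zeta_ge0.
Qed.

Lemma lyapunov_supersolution n : n != y ->
  lemx (ones + step lyapunov n) (lyapunov n).
Proof.
rewrite neq_ltn => /orP[ny|].
  (* From below [y] one step reaches at most layer [y], where [lyapunov] still equals [height]. *)
  rewrite [X in lemx _ X](lyapunov_low (ltnW ny)).
  apply: lemx_trans (height_supersolution ny); apply: lemxD => //.
  by case: n ny => [|n] ny; rewrite /step !lyapunov_low// ltnW// ltnW.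
case: n => // n yn.
(* Here [B] contains [P *m zet]; moved to the right, it combines with [P *m h] into [P] applied to
   [lyapunov n.+2], which yields the full [step]. *)
have e : (1%:M - B n.+1) *m lyapunov n.+1 =
         ones + P n.+1 *m h n.+2 + Q n.+1 *m lyapunov n.
  by rewrite [in LHS]lyapunov_high// mulmxDr hE mulmxA zeta_eq.
suff -> : lyapunov n.+1 = ones + step lyapunov n.+1 by [].
move: e; rewrite mulmxBl mul1mx => /eqP; rewrite subr_eq => /eqP {1}->.
rewrite /step (lyapunov_high (ltnW yn)) /B mulmxDl mulmxDr mulmxA.
set a := P _ *m h _; set b := R _ *m _; set c := Q _ *m _.
set e := P _ *m _ *m _.
by apply/matrixP => i j; rewrite !mxE; ring.
Qed.

End Lyapunov.

Lemma hit_bounded C : (forall N, lemx (Au_sum N 1) C) ->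
  forall y n, exists C', forall t, lemx (hit y t n) C'.
Proof.
move=> /Au_tail_exists[h [h0 hE]] y n; exists (lyapunov h y n) => t.
apply: hit_le_supersolution => [m|m]; first exact: lyapunov_ge0.
exact: lyapunov_supersolution.
Qed.

End ReflectingWalk.

(** * Nonnegative series and finite additivity of probabilities *)

Lemma nneseries_ltyP (K : realType) (m : nat) (a : nat -> K) :
  (forall k, (m <= k)%N -> 0 <= a k) ->
  ((\sum_(m <= k <oo) (a k)%:E < +oo)%E <->
   exists C, forall n, \sum_(m <= k < m + n) a k <= C).
Proof.
move=> a0; have a0' k : (m <= k)%N -> xpredT k -> (0 <= (a k)%:E)%E.
  by move=> mk _; rewrite lee_fin a0.
split=> [fin|[C hC]].
  exists (fine (\sum_(m <= k <oo) (a k)%:E)%E) => n.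
  rewrite -lee_fin fineK; last by rewrite ge0_fin_numE// nneseries_ge0.
  by rewrite -sumEFin; exact: nneseries_lim_ge.
apply: (@le_lt_trans _ _ C%:E); last exact: ltry.
apply: lime_le; first exact: is_cvg_nneseries.
apply: nearW => n; rewrite sumEFin lee_fin.
have [mn|/ltnW nm] := leqP m n; first by rewrite -(subnKC mn).
by rewrite big_geq//; have := hC 0%N; rewrite addn0 big_geq.
Qed.

Section MarkovChain.
Context {K : realType} {dsp : measure_display} {Omega : measurableType dsp}.
Context (Pr : probability Omega K).

Lemma measurable_mem_seq (S : eqType) (Y : Omega -> S) (r : seq S) :
  (forall z, measurable (Y @^-1` [set z])) ->
  measurable [set w | Y w \in r].
Proof.
move=> mY; elim: r => [|z r IH].
  by rewrite (_ : [set _ | _] = set0)//; apply/seteqP; split.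
rewrite (_ : [set _ | _] = Y @^-1` [set z] `|` [set w | Y w \in r]).
  exact: measurableU.
apply/seteqP; split=> w /=; rewrite inE.
  by case/orP => [/eqP|]; [left|right].
by case=> [->|->]; rewrite ?eqxx ?orbT.
Qed.

Lemma probability_sum_values (S : eqType) (Y : Omega -> S) (r : seq S)
    (E : set Omega) :
  (forall z, measurable (Y @^-1` [set z])) -> measurable E -> uniq r ->
  Pr (E `&` [set w | Y w \in r]) =
  (\sum_(z <- r) Pr (E `&` Y @^-1` [set z]))%E.
Proof.
move=> mY mE; elim: r => [_|z r IH /andP[zr ur]].
  rewrite big_nil (_ : _ `&` _ = set0) ?measure0//.
  by apply/seteqP; split=> w [].
rewrite big_cons -IH// (measureDI _ _ (mY z)); last first.
  by apply: measurableI => //; exact: measurable_mem_seq.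
rewrite addeC; congr (_ + _)%E; congr (Pr _); apply/seteqP; split=> w /=.
- by case=> -[].
- by case=> Ew Yz; split=> //; split=> //; rewrite Yz mem_head.
- by case=> -[Ew]; rewrite inE => /orP[/eqP|].
- case=> Ew Yr; split; first by split=> //; rewrite inE Yr orbT.
  by move=> Yz; move: zr; rewrite -Yz Yr.
Qed.

(** The set [A] minus [B] is null, by cancelling the finite [Pr A], and it contains [E] minus
    [B]. *)
Lemma probability_setI_full (A B E : set Omega) :
  measurable A -> measurable B -> measurable E -> E `<=` A ->
  Pr (A `&` B) = Pr A -> Pr (E `&` B) = Pr E.
Proof.
move=> mA mB mE EA AB.
have -> : Pr E = (Pr (E `\` B) + Pr (E `&` B))%E by exact: measureDI.
suff -> : Pr (E `\` B) = 0%E by rewrite add0e.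
apply/eqP; rewrite eq_le measure_ge0 andbT.
apply: (@le_trans _ _ (Pr (A `\` B))).
  by apply: le_measure; rewrite ?inE//; [exact: measurableD..|exact: setSD].
have : Pr A = (Pr (A `\` B) + Pr (A `&` B))%E by exact: measureDI.
rewrite AB.
have : Pr A \is a fin_num by exact: fin_num_measure.
have : Pr (A `\` B) \is a fin_num by apply: fin_num_measure; exact: measurableD.
case: (Pr _) => // a _; case: (Pr _) => // b _ [] /eqP.
by rewrite -subr_eq subrr => /eqP <-.
Qed.

End MarkovChain.

(** * Law of the return time to a layer *)

Section LayerReturn.
Context {K : realType} {d : nat} (P Q R : nat -> 'M[K]_d).
Hypothesis hPQR : block_transitions P Q R.

(** Layers up to [n.+1] contain every possible target; peeling off the top three gives the [P], [R]
    and [Q] terms, and the others vanish. *)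
Lemma transition_sum n i (f : nat -> 'cV[K]_d) :
  \sum_(m < n.+2) \sum_(j < d) transition P Q R (n, i) (m : nat, j) * f m j 0 =
  step P Q R f n i 0.
Proof.
rewrite big_ord_recr/= [X in _ + X](_ : _ = (P n *m f n.+1) i 0); last first.
  by rewrite mxE; apply: eq_bigr => j _; rewrite /transition/= eqxx.
rewrite big_ord_recr/=; case: n => [|n].
  rewrite big_ord0 big1 ?addr0 ?add0r// => j _.
  by rewrite /transition/= mul0r.
rewrite [X in _ + X + _](_ : _ = (R n.+1 *m f n.+1) i 0); last first.
  rewrite mxE; apply: eq_bigr => j _.
  by rewrite /transition/= eqxx ltn_eqF.
rewrite big_ord_recr/= [X in _ + X + _ + _](_ : _ = (Q n.+1 *m f n) i 0); last first.
  rewrite mxE; apply: eq_bigr => j _.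
  by rewrite /transition/= eqxx !ltn_eqF.
rewrite big1 => [|m _]; first by rewrite !mxE add0r [_ + \sum_j R _ _ _ * _]addrC
  [LHS]addrC addrA.
apply: big1 => j _; rewrite /transition/=.
have mn := ltn_ord m.
by rewrite !ltn_eqF ?mul0r//= ltnS ?ltnS ltnW// ltnW.
Qed.

Context {dsp : measure_display} {Omega : measurableType dsp}.
Context (X : nat -> Omega -> strip d).

Definition cylinder (n : nat) (s : nat -> strip d) : set Omega :=
  [set w | forall k, (k <= n)%N -> X k w = s k].

(** Time [n] itself is unconstrained, since a return counts from the next step on. *)
Definition avoid (y n t : nat) : set Omega :=
  [set w | forall k, (0 < k <= t)%N -> (X (n + k) w).1 != y].

Lemma avoid0 y n : avoid y n 0 = setT.
Proof. by apply/seteqP; split=> // w _ [|k]. Qed.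

(** Layer-cake formula: [avoid y 0 t] is the event that the return time exceeds [t]. Without a
    return every indicator is 1 and both sides are infinite. *)
Lemma return_timeE y w :
  return_time K X y w = (\sum_(0 <= t <oo) (\1_(avoid y 0 t) w)%:E)%E.
Proof.
have ind0 t : (0 <= (\1_(avoid y 0 t) w)%:E :> \bar K)%E by rewrite lee_fin indicE.
pose p t := (0 < t)%N && ((X t w).1 == y).
have [ex|nex] := pselect (exists t, p t).
  case: (ex_minnP ex) => T /andP[T0 XT] Tmin.
  have indE t : (\1_(avoid y 0 t) w = (t < T)%N%:R :> K).
    rewrite indicE; congr ((nat_of_bool _)%:R); apply/idP/idP.
      rewrite inE => /(_ T); rewrite add0n T0 XT/= => h; rewrite ltnNge.
      by apply/negP => /h.
    move=> tT; rewrite inE => k /andP[k0 kt]; rewrite add0n; apply/negP => Xk.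
    by have := Tmin k; rewrite /p k0 Xk leqNgt (leq_ltn_trans kt tT) => /(_ isT).
  rewrite (nneseries_split 0 T)// add0n [X in (_ + X)%E]eseries0 ?adde0; last first.
    by move=> t Tt _; rewrite indE ltnNge Tt.
  rewrite sumEFin big_nat; under eq_bigr => t /andP[_ tT] do rewrite indE tT.
  rewrite -big_nat sumr_const_nat subn0; apply/eqP; rewrite eq_le; apply/andP; split.
    by apply: ereal_inf_lbound; exists T => //; split=> //; exact/eqP.
  apply/ereal_infP => _ [t [t0 Xt] <-]; rewrite lee_fin ler_nat; apply: Tmin.
  by rewrite /p t0; apply/eqP.
have -> : return_time K X y w = +oo%E.
  rewrite /return_time (_ : [set _ | _ in _] = set0) ?ereal_inf0//.
  apply/seteqP; split=> // z [t [t0 Xt] _]; apply: nex.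
  by exists t; rewrite /p t0; apply/eqP.
have indE t : (\1_(avoid y 0 t) w = 1 :> K).
  rewrite indicE (_ : w \in _)// inE => k /andP[k0 _]; rewrite add0n.
  by apply/negP => Xk; apply: nex; exists k; rewrite /p k0.
apply/esym/eqP; rewrite -leye_eq leNgt; apply/negP.
move=> /(@nneseries_ltyP _ 0 (fun t => \1_(avoid y 0 t) w))-/(_ (fun t _ => ind0 t)).
move=> [C hC]; have := hC (Num.bound C); rewrite add0n.
under eq_bigr do rewrite indE.
rewrite sumr_const_nat subn0 leNgt archi_boundP//.
by have := hC 0%N; rewrite big_geq.
Qed.

Context (Pr : probability Omega K) (nu : strip d -> K).
Hypothesis hX : markov_chain Pr X nu (transition P Q R).

Lemma measurable_cylinder n s : measurable (cylinder n s).
Proof.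
rewrite (_ : cylinder n s = \bigcap_(k in `I_n.+1) (X k @^-1` [set s k])).
  by apply: bigcap_measurableType => k _; case: hX.
by apply/seteqP; split=> w h k; exact: h.
Qed.

Lemma measurable_avoid y n t : measurable (avoid y n t).
Proof.
rewrite (_ : avoid y n t = \bigcap_(k in [set k | (0 < k <= t)%N])
   ~` [set w | X (n + k) w \in [seq (y, j) | j <- enum 'I_d]]).
  apply: bigcap_measurableType => k _; apply: measurableC.
  by apply: measurable_mem_seq => z; case: hX.
apply/seteqP; split=> w h k kt.
  by move=> /mapP[j _ e]; move: (h k kt); rewrite e eqxx.
apply/negP => /eqP e; apply: (h k kt); apply/mapP.
exists (X (n + k) w).2; first by rewrite mem_enum.
by rewrite -e -surjective_pairing.
Qed.

Lemma cylinderS n s :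
  Pr (cylinder n.+1 s) = (Pr (cylinder n s) * (transition P Q R (s n) (s n.+1))%:E)%E.
Proof. by case: hX => _ _ h; exact: h. Qed.

Let targets n : seq (strip d) :=
  map (fun z : 'I_n.+2 * 'I_d => (val z.1, z.2)) (enum {: 'I_n.+2 * 'I_d}).

Let targets_uniq n : uniq (targets n).
Proof.
by rewrite map_inj_uniq ?enum_uniq// => -[a b] [a' b'] [/val_inj -> ->].
Qed.

Let targets_sum n (F : strip d -> \bar K) :
  (\sum_(z <- targets n) F z = \sum_(m < n.+2) \sum_(j < d) F (m : nat, j))%E.
Proof. by rewrite big_map big_enum/= pair_bigA. Qed.

(** The Markov property speaks of whole sequences [s]; changing [s] at time [n.+1] varies the next
    state and keeps the cylinder up to [n]. *)
Let set_next n (s : nat -> strip d) z k := if k == n.+1 then z else s k.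

Let cylinder_set_next n s z : cylinder n (set_next n s z) = cylinder n s.
Proof.
by apply/seteqP; split=> w h k kn; rewrite (h k kn) /set_next ltn_eqF.
Qed.

Let cylinder_next n s z :
  cylinder n.+1 (set_next n s z) = cylinder n s `&` X n.+1 @^-1` [set z].
Proof.
apply/seteqP; split=> [w h|w [h e] k].
  split; last by rewrite /= h// /set_next eqxx.
  by move=> k kn; rewrite h 1?ltnW// /set_next ltn_eqF.
rewrite leq_eqVlt => /orP[/eqP ->|kn]; first by rewrite /set_next eqxx.
by rewrite h// /set_next ltn_eqF.
Qed.

Let probability_next n s z :
  Pr (cylinder n s `&` X n.+1 @^-1` [set z]) =
  (Pr (cylinder n s) * (transition P Q R (s n) z)%:E)%E.
Proof.
rewrite -cylinder_next cylinderS cylinder_set_next /set_next eqxx.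
by rewrite ltn_eqF.
Qed.

Let probability_cylinderE n s : exists c, Pr (cylinder n s) = c%:E.
Proof.
have : Pr (cylinder n s) \is a fin_num.
  by apply: fin_num_measure; exact: measurable_cylinder.
by case: (Pr _) => // c _; exists c.
Qed.

(* Finite additivity suffices: the steps to the finitely many states reachable
   from [s n] already carry the whole mass of the cylinder. *)
Let probability_split n s (E : set Omega) : measurable E -> E `<=` cylinder n s ->
  Pr E = (\sum_(m < (s n).1.+2) \sum_(j < d)
            Pr (E `&` X n.+1 @^-1` [set (m : nat, j)]))%E.
Proof.
move=> mE Es; have mX k z : measurable (X k @^-1` [set z]) by case: hX.
rewrite -(targets_sum _ (fun z => Pr (E `&` X n.+1 @^-1` [set z]))).
rewrite -probability_sum_values//.
apply/esym/(@probability_setI_full _ _ _ _ (cylinder n s)) => //.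
- exact: measurable_cylinder.
- exact: measurable_mem_seq.
rewrite probability_sum_values ?targets_sum//; last exact: measurable_cylinder.
have [c cE] := probability_cylinderE n s.
under eq_bigr do under eq_bigr do rewrite probability_next cE -EFinM.
under eq_bigr do rewrite sumEFin.
rewrite sumEFin cE; congr _%:E.
under eq_bigr do rewrite -mulr_sumr.
rewrite -mulr_sumr; case: (s n) => a i.
have := transition_sum a i (fun=> const_mx 1); rewrite step_cst// mxE.
move=> h; rewrite [X in c * X](_ : _ = 1) ?mulr1// -[RHS]h.
by do 2 (apply: eq_bigr => ? _); rewrite mxE mulr1.
Qed.

(** Induction on [t], splitting over the state at time [n.+1]: in layer [y] both sides vanish,
    elsewhere that state extends the cylinder. The factor is a [step] of [surv] because [s n] may
    lie in layer [y]. *)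
Lemma probability_avoid_after y n t s :
  Pr (cylinder n s `&` avoid y n t) =
  (Pr (cylinder n s) *
   (if t is t'.+1 then step P Q R (surv P Q R y t') (s n).1 (s n).2 0 else 1)%:E)%E.
Proof.
elim: t n s => [|t IH] n s; first by rewrite avoid0 setIT mule1.
rewrite (probability_split (s := s) (n := n)); first last.
- by move=> w [].
- by apply: measurableI; [exact: measurable_cylinder|exact: measurable_avoid].
have [c cE] := probability_cylinderE n s.
have term z : Pr (cylinder n s `&` avoid y n t.+1 `&` X n.+1 @^-1` [set z]) =
    (c * (transition P Q R (s n) z * surv P Q R y t z.1 z.2 0))%:E.
  have [zy|zy] := eqVneq z.1 y.
    rewrite zy surv_at mxE !mulr0 (_ : _ `&` _ = set0) ?measure0//.
    apply/seteqP; split=> // w [[_ /(_ 1%N isT)]].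
    by rewrite addn1 => + /= e; rewrite e zy eqxx.
  rewrite (_ : _ `&` _ = cylinder n.+1 (set_next n s z) `&` avoid y n.+1 t).
    rewrite IH cylinder_next probability_next cE mulrA [RHS]EFinM -EFinM.
    congr (_ * _%:E)%E; rewrite /set_next eqxx.
    by case: t {IH} => [|t]; rewrite /= (negPf zy)// mxE.
  rewrite cylinder_next; apply/seteqP; split=> [w [[h a] e]|w [[h e] a]].
    split=> // k /andP[k0 kt]; rewrite addSnnS; apply: a.
    exact: kt.
  split=> //; split=> // -[|[|k]]// kt; first by rewrite addn1 e.
  by rewrite -addSnnS; apply: a.
under eq_bigr do under eq_bigr do rewrite term.
under eq_bigr do rewrite sumEFin.
rewrite sumEFin cE -EFinM; congr _%:E.
under eq_bigr do rewrite -mulr_sumr.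
rewrite -mulr_sumr; congr (_ * _).
by case: (s n) => a i; exact: transition_sum.
Qed.

End LayerReturn.

(** * Finiteness of the mean return time from a fixed state *)

Section LayerReturnMean.
Context {K : realType} {d : nat} (P Q R : nat -> 'M[K]_d).
Hypothesis hPQR : block_transitions P Q R.
Context {dsp : measure_display} {Omega : measurableType dsp}.
Context (X : nat -> Omega -> strip d) (Pr : probability Omega K) (x : strip d).
Hypothesis hX : markov_chain Pr X (point_init K x) (transition P Q R).

Lemma probability_avoid y t :
  Pr (avoid X y 0 t) = (if t is t'.+1
    then step P Q R (surv P Q R y t') x.1 x.2 0 else 1)%:E.
Proof.
have X0 : Pr (cylinder X 0 (fun=> x)) = 1%E.
  case: hX => _ h _; have := h x; rewrite /point_init eqxx => <-.
  congr (Pr _); apply/seteqP; split=> w; first exact.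
  by move=> e k; rewrite leqn0 => /eqP ->.
have := probability_avoid_after hPQR hX y 0 t (fun=> x).
rewrite X0 mul1e => <-; rewrite setIC; apply/esym.
apply: (@probability_setI_full _ _ _ _ setT) => //.
- exact: (measurable_cylinder hX).
- exact: (measurable_avoid hX).
- by rewrite setTI X0 probability_setT.
Qed.

(** The mean is the sum of the tail probabilities, whose partial sums are [1 + step (hit y t)]. *)
Lemma return_time_mean_ltyP y :
  (\int[Pr]_(w in [set: Omega]) return_time K X y w < +oo)%E <->
  exists C, forall t, step P Q R (hit P Q R y t) x.1 x.2 0 <= C.
Proof.
pose a t := if t is t'.+1
  then step P Q R (surv P Q R y t') x.1 x.2 0 else 1.
have a0 t : 0 <= a t.
  case: t => // t; have := @step_ge0 _ _ _ _ _ hPQR (surv P Q R y t) x.1.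
  by move=> /(_ (surv_ge0 hPQR y t)) /(_ x.2 0); rewrite mxE.
rewrite (_ : (\int[Pr]_(w in _) _)%E = (\sum_(0 <= t <oo) (a t)%:E)%E); last first.
  under eq_integral do rewrite return_timeE.
  rewrite integral_nneseries//; last first.
    move=> t; apply/measurable_realfun.measurable_EFinP.
    apply: measurable_realfun.measurable_indic.
    exact: (measurable_avoid hX).
  apply: eq_eseriesr => t _; rewrite integral_indic//; last exact: (measurable_avoid hX).
  by rewrite setIT; exact: probability_avoid.
have sumE t : \sum_(0 <= k < 0 + t.+1) a k = 1 + step P Q R (hit P Q R y t) x.1 x.2 0.
  rewrite add0n big_nat_recl// big_mkord; congr (1 + _).
  by rewrite /hit step_sum summxE.
rewrite nneseries_ltyP//; split=> [[C hC]|[C hC]].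
  by exists (C - 1) => t; rewrite lerBrDl -sumE.
(* The absolute value makes the bound cover the empty sum as well. *)
exists (1 + `|C|) => -[|t]; first by rewrite big_geq// addr_ge0.
by rewrite sumE lerD2l; apply: le_trans (ler_norm C).
Qed.

End LayerReturnMean.

Theorem theorem1p2 (K : realType) (d : nat) (hd : (0 < d)%N)
    (P Q R : nat -> 'M[K]_d) (hPQR : block_transitions P Q R)
    (hC1 : cond_C1 P Q R) (hC2 : cond_C2 P Q) (hC3 : cond_C3 P Q R)
    (rho : 'M[K]_d) (hrho : stochastic rho)
    (hzeta : forall n : nat, (0 < n)%N ->
       cvg (zeta_trunc P Q R rho n a @[a --> \oo]))
    (dsp : measure_display) (Omega : measurableType dsp)
    (X : nat -> Omega -> strip d)
    (mu : 'I_d -> K) (hmu : prob_vector mu)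
    (Prmu : probability Omega K)
    (hXmu : markov_chain Prmu X (layer0_init mu) (transition P Q R))
    (Pr : strip d -> probability Omega K)
    (hX : forall x : strip d,
       markov_chain (Pr x) X (point_init K x) (transition P Q R)) :
  positive_recurrent Pr X <-> (varrho P Q R rho < +oo)%E.
Proof.
have term_ge0 j k : (1 <= k)%N ->
    0 <= (\big[mulmx/1%:M]_(1 <= m < k) A_mx P Q R rho m *m u_vec P Q R rho k) j 0.
  move=> k1; have := @mulmx_ge0 K d d 1 (\big[mulmx/1%:M]_(1 <= m < k) A_mx P Q R rho m)
    (u_vec P Q R rho k).
  move=> h; have := h _ _ j 0; rewrite [X in X <= _]mxE; apply.
    rewrite big_nat; apply: big_ind => [i l|A B|m /andP[m1 _]].
    - by rewrite !mxE ler0n.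
    - exact: mulmx_ge0.
    - exact: (A_ge0 hPQR hC1 hrho hzeta).
  exact: (u_ge0 hPQR hC1 hrho hzeta).
have seriesP j : (Au_series P Q R rho j < +oo)%E <->
    exists C, forall N, Au_sum P Q R rho N 1 j 0 <= C.
  rewrite /Au_series nneseries_ltyP; last by move=> k; exact: term_ge0.
  by split=> -[C hC]; exists C => N; have := hC N; rewrite Au_sumE summxE.
have coefE j : ((const_mx 1 : 'rV[K]_d) *m P 0%N) 0 j = \sum_i P 0%N i j.
  by rewrite mxE; apply: eq_bigr => i _; rewrite mxE mul1r.
have series_ge0 j : (0 <= Au_series P Q R rho j)%E.
  by apply: nneseries_ge0 => k k1 _; rewrite lee_fin; exact: term_ge0.
split=> [rec|fin].
  have /choice[C hC] i : exists C, forall t, step P Q R (hit P Q R 0 t) 0 i 0 <= C.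
    exact/(return_time_mean_ltyP hPQR (hX (0%N, i)) 0%N)/rec.
  (* From layer 0 one step is [P 0 *m hit 0 t 1], so positive column sums of [P 0] bound [hit] at
     layer 1. *)
  have [|t|t|C' hC'] := @lemx_col_pos_bound K d (P 0%N) (fun t => hit P Q R 0 t 1)
      (\col_i C i) (P_ge0 hPQR 0).
  - exact: hC2.1.
  - exact: hit_ge0.
  - by move=> i j; rewrite ord1 [X in _ <= X]mxE; exact: hC.
  have [h hh] := Au_sum_le_hit hPQR hC1 hrho hzeta hC2 hC'.
  apply: lte_add_pinfty; last exact: ltry.
  apply: lte_sum_pinfty => j _; apply: lte_mul_pinfty => //.
    by rewrite coefE lee_fin ltW// hC2.1.
  by apply/seriesP; exists (h j 0) => N; exact: hh.
have /choice[C hC] j : exists C, forall N, Au_sum P Q R rho N 1 j 0 <= C.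
  (* Coordinate [j] carries a column sum of [P 0], positive by [cond_C2], so an infinite coordinate
     would make [varrho] infinite. *)
  apply/seriesP; have coef0 : 0 < \sum_i P 0%N i j by exact: hC2.1.
  rewrite ltNge leye_eq; apply/negP => /eqP e; move: fin.
  rewrite /varrho (bigD1 j)//= e coefE gt0_muley ?lte_fin// addye ?addye//.
  rewrite gt_eqF// (lt_le_trans (ltNyr 0))// sume_ge0// => l _.
  by apply: mule_ge0 => //; rewrite coefE lee_fin ltW// hC2.1.
have bd := @hit_bounded _ _ _ _ _ hPQR hC1 _ hrho hzeta hC2 (\col_j C j).
have {bd}bd : forall y n, exists C', forall t, lemx (hit P Q R y t n) C'.
  by apply: bd => N i j; rewrite ord1 [X in _ <= X]mxE.
move=> y x xy; apply/(return_time_mean_ltyP hPQR (hX x) y).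
have /choice[V hV] := bd y.
(* The return time starts with one free step from [x], so the bounds [V] on [hit] are passed through
   the monotone [step]. *)
exists (step P Q R V x.1 x.2 0) => t.
by apply: (step_le hPQR) => m _; exact: hV.
Qed.
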